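(* Consider the composite reduced basis coupled ROM-FOM problem with a ROM on $\Omega_1$ and a FOM on $\Omega_2$, with the Lagrange multiplier represented either by the reduced interface basis $\Phi_{1,\gamma}$ from the ROM side (option rLM) or by the full interface finite element space $G^h_2$ from the FOM side (option fLM). Then, for either option, and for any mesh size and any dimensions of the composite reduced basis, the Schur complement $$ \widehat S=\widehat G_1\widetilde M_1^{-1}\widehat G_1^T+\widehat G_2M_{2,D}^{-1}\widehat G_2^T $$ is symmetric and positive definite (in particular, non-singular).
   Context: Setting. $\Omega\subset\mathbb{R}^\nu$, $\nu\in\{2,3\}$, is a bounded region divided by an interface $\gamma$ into two non-overlapping subdomains $\Omega_1,\Omega_2$; $\Gamma_i=\partial\Omega_i\setminus\gamma$. For $i=1,2$, $\Omega_i^h$ is a quasi-uniform finite element partition of $\Omega_i$; the two subdomains are meshed independently. The partitions $\gamma^h_1,\gamma^h_2$ of $\gamma$ induced by them are spatially coincident but their vertices need not match. Finite element spaces. $S^h_i\subset H^1(\Omega_i)$ is the lowest-order nodal $C^0$ finite element space on $\Omega^h_i$ with nodal Lagrange basis $\{N_{i,r}\}$. Nodes are classified as Dirichlet nodes (on $\Gamma_i$, including nodes on both $\Gamma_i$ and $\gamma$), interface nodes (the remaining nodes on $\gamma$; there are $n_{i,\gamma}$ of them), and interior nodes ($n_{i,0}$ of them). $S^h_{i,\gamma}$ is the span of the nodal basis functions of the interface nodes, and $G^h_i=S^h_{i,\gamma}|_\gamma$ is its trace space on $\gamma$, with basis given by the traces of those nodal basis functions. Matrices. For $p,q\in\{\gamma,0\}$,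 $M_{i,pq}\in\mathbb{R}^{n_{i,p}\times n_{i,q}}$ is the block of the $L^2(\Omega_i)$ mass matrix (entries $\int_{\Omega_i}N_{i,r}N_{i,s}\,dx$) with rows indexed by interface ($p=\gamma$) or interior ($p=0$) nodes and columns likewise by $q$. Let $k=1$ for option rLM and $k=2$ for option fLM. $G_{i,\gamma}\in\mathbb{R}^{n_{k,\gamma}\times n_{i,\gamma}}$ has entries $\int_\gamma N_{k,r}N_{i,s}\,ds$, with $r$ ranging over the interface nodes of $\Omega^h_k$ and $s$ over the interface nodes of $\Omega^h_i$. Reduced bases. For $p\in\{\gamma,0\}$, $\Phi_{1,p}\in\mathbb{R}^{n_{1,p}\times d_{1,p}}$, $0<d_{1,p}\le n_{1,p}$, is a POD reduced basis matrix: its columns are the first $d_{1,p}$ left singular vectors (hence orthonormal) of a snapshot matrix with $n_{1,p}$ rows. The interface and interior bases are computed independently; the pair $\{\Phi_{1,\gamma},\Phi_{1,0}\}$ is the composite reduced basis on $\Omega_1$. Coupled ROM-FOM problem. With $\widetilde M_{1,pq}=\Phi_{1,p}^TM_{1,pq}\Phi_{1,q}$, $$ \widetilde M_1=\begin{bmatrix}\widetilde M_{1,\gamma\gamma}&\widetilde M_{1,\gamma0}\\ \widetilde M_{1,0\gamma}&\widetilde M_{1,00}\end{bmatrix},\qquad M_{2,D}=\begin{bmatrix}M_{2,\gamma\gamma}&M_{2,\gamma0}\\ M_{2,0\gamma}&M_{2,00}\end{bmatrix},\qquad \widehat G_i=\begin{bmatrix}\widehat G_{i,\gamma}&0\end{bmatrix},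 $$ where the zero block of $\widehat G_1$ has $d_{1,0}$ columns, that of $\widehat G_2$ has $n_{2,0}$ columns, and $$ \text{option rLM: }\ \widehat G_{1,\gamma}=\Phi_{1,\gamma}^TG_{1,\gamma}\Phi_{1,\gamma},\ \ \widehat G_{2,\gamma}=\Phi_{1,\gamma}^TG_{2,\gamma}; \qquad \text{option fLM: }\ \widehat G_{1,\gamma}=G_{1,\gamma}\Phi_{1,\gamma},\ \ \widehat G_{2,\gamma}=G_{2,\gamma}. $$ The matrix of the coupled ROM-FOM problem is $$ \begin{bmatrix}\widetilde M_1&0&\widehat G_1^T\\0&M_{2,D}&-\widehat G_2^T\\ \widehat G_1&-\widehat G_2&0\end{bmatrix}. $$ *)

(* Defs.v *)
From HB Require Import structures.
From mathcomp Require Import all_boot all_order all_algebra.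
From mathcomp Require Import all_classical all_reals all_analysis.
Set Implicit Arguments.
Unset Strict Implicit.
Unset Printing Implicit Defensive.
Import Order.TTheory GRing.Theory Num.Theory.
Import numFieldNormedType.Exports.
Local Open Scope classical_set_scope.
Local Open Scope ring_scope.

Section LebesgueTuple.
Variable R : realType.

Definition tuple_pair n (p : measurableTypeR R * n.-tuple (measurableTypeR R)) :
  n.+1.-tuple (measurableTypeR R) := [tuple of p.1 :: p.2].

Lemma measurable_tuple_pair n : measurable_fun setT (@tuple_pair n).
Proof. exact: measurable_cons. Qed.

Lemma measurable_tuple_unpair n :
  measurable_fun [set: n.+1.-tuple (measurableTypeR R)]
    (fun t => (thead t, [tuple of behead t])).
Proof.
apply/measurable_fun_pairP; split; last exact: measurable_behead.
exact: measurable_tnth.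
Qed.

Section cons.
Variables (n : nat)
  (mu : {sigma_finite_measure set (n.-tuple (measurableTypeR R)) -> \bar R}).

Let prodm : {measure set _ -> \bar R} := (@lebesgue_measure R \x mu)%E.

Definition lebesgue_cons : set (n.+1.-tuple (measurableTypeR R)) -> \bar R :=
  pushforward (@lebesgue_measure R \x mu)%E (@tuple_pair n).

Let lebesgue_cons0 : lebesgue_cons set0 = 0%E.
Proof. by rewrite /lebesgue_cons /pushforward preimage_set0 measure0. Qed.

Let lebesgue_cons_ge0 A : (0 <= lebesgue_cons A)%E.
Proof. exact: (measure_ge0 prodm). Qed.

Let preimage_measurable (A : set (n.+1.-tuple (measurableTypeR R))) :
  measurable A -> measurable (@tuple_pair n @^-1` A).
Proof.
by move=> mA; rewrite -[X in measurable X]setTI; exact: measurable_tuple_pair.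
Qed.

Let lebesgue_cons_sigma_additive : semi_sigma_additive lebesgue_cons.
Proof.
move=> F mF tF mUF; rewrite /lebesgue_cons /pushforward preimage_bigcup.
apply: (measure_semi_sigma_additive (s := prodm)).
- by move=> k; exact: preimage_measurable.
- apply/trivIsetP => /= i j _ _ ij; rewrite -preimage_setI.
  by move/trivIsetP : tF => /(_ _ _ _ _ ij) ->//; rewrite preimage_set0.
- by rewrite -preimage_bigcup; exact: preimage_measurable.
Qed.

HB.instance Definition _ := isMeasure.Build _ _ _ lebesgue_cons
  lebesgue_cons0 lebesgue_cons_ge0 lebesgue_cons_sigma_additive.

Let lebesgue_cons_sigma_finite : sigma_finite setT lebesgue_cons.
Proof.
have /sigma_finiteP[F [TF ndF Foo]] := sigma_finiteT (@lebesgue_measure R).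
have /sigma_finiteP[G [TG ndG Goo]] := sigma_finiteT mu.
pose unpair (t : n.+1.-tuple (measurableTypeR R)) :=
  (thead t, [tuple of behead t]).
exists (fun k => unpair @^-1` (F k `*` G k)).
  apply/seteqP; split => // t _.
  have [i _ Fi] : (\bigcup_i F i) (thead t) by rewrite -TF.
  have [j _ Gj] : (\bigcup_i G i) [tuple of behead t] by rewrite -TG.
  exists (maxn i j) => //; split.
  - by move: Fi; exact/subsetPset/ndF/leq_maxl.
  - by move: Gj; exact/subsetPset/ndG/leq_maxr.
move=> k; have [mF Fk] := Foo k; have [mG Gk] := Goo k; split.
  by rewrite -[X in measurable X]setTI; apply: measurable_tuple_unpair => //;
    exact: measurableX.
rewrite /lebesgue_cons /pushforward -comp_preimage (_ : _ \o _ = id).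
  by rewrite preimage_id product_measure1E// lte_mul_pinfty// ge0_fin_numE.
by apply/funext => -[x t] /=; congr pair; apply/val_inj.
Qed.

HB.instance Definition _ := Measure_isSigmaFinite.Build _ _ _ lebesgue_cons
  lebesgue_cons_sigma_finite.

End cons.

(* n-dimensional Lebesgue measure, as an iterated product of the
   one-dimensional one. *)
Fixpoint lebesgue_tuple n :
    {sigma_finite_measure set (n.-tuple (measurableTypeR R)) -> \bar R} :=
  match n with
  | 0 => \d_([tuple] : 0.-tuple (measurableTypeR R))
  | m.+1 => lebesgue_cons (lebesgue_tuple m)
  end.
End LebesgueTuple.

Section Integrals.
Variable R : realType.

Definition row_of_tuple n (t : n.-tuple (measurableTypeR R)) : 'rV[R]_n :=
  \row_j tnth t j.

(* The Borel structure lives on tuples and the topology on row vectors; the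
   integral over a subset of R^n is transported along the obvious bijection. *)
Definition integral_rV n (A : set 'rV[R]_n) (f : 'rV[R]_n -> R) : R :=
  \int[lebesgue_tuple R n]_(t in @row_of_tuple n @^-1` A) f (row_of_tuple t).

Definition boundary (T : topologicalType) (A : set T) : set T :=
  closure A `\` A^°.

End Integrals.

(* Reference cells of dimension m: the unit simplex and the unit cube.  They
   cover triangles and tetrahedra (P1), quadrilaterals and hexahedra (Q1), and,
   one dimension lower, their facets. *)
Inductive shape := Simplex | Cube.

Definition vertex (sh : shape) (m : nat) : finType :=
  match sh with
  | Simplex => 'I_m.+1
  | Cube => {ffun 'I_m -> bool}
  end.

Section Cells.
Variable R : realType.

Definition ref_cell (sh : shape) m : set 'rV[R]_m :=
  match sh with
  | Simplex => [set xi | (forall j, 0 <= xi ord0 j) /\ \sum_j xi ord0 j <= 1]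
  | Cube => [set xi | forall j, 0 <= xi ord0 j <= 1]
  end.
Arguments ref_cell : clear implicits.

(* Lagrange basis of P1 (barycentric coordinates; vertex 0 is the origin and
   vertex j + 1 the j-th unit vector), resp. of Q1. *)
Definition ref_basis (sh : shape) m : vertex sh m -> 'rV[R]_m -> R :=
  match sh return vertex sh m -> 'rV[R]_m -> R with
  | Simplex => fun a xi =>
      if unlift ord0 a is Some j then xi ord0 j else 1 - \sum_j xi ord0 j
  | Cube => fun a xi =>
      \prod_j (if a j then xi ord0 j else 1 - xi ord0 j)
  end.

Definition ref_face (sh : shape) m : set {set vertex sh m} :=
  match sh return set {set vertex sh m} with
  | Simplex => [set: _]
  | Cube => [set A | A = finset.set0 \/
      exists (J : {set 'I_m}) (b : {ffun 'I_m -> bool}),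
        A = finset (fun g : {ffun 'I_m -> bool} =>
                      [forall j in J, g j == b j])]
  end.

(* Facets of the (d+1)-dimensional reference cell: opposite to a vertex of the
   simplex, resp. one coordinate of the cube frozen to 0 or 1. *)
Definition ref_facet (sh : shape) d : finType :=
  match sh with
  | Simplex => 'I_d.+2
  | Cube => ('I_d.+1 * bool)%type
  end.

Definition facet_vertex (sh : shape) d :
    ref_facet sh d -> vertex sh d -> vertex sh d.+1 :=
  match sh return ref_facet sh d -> vertex sh d -> vertex sh d.+1 with
  | Simplex => fun f a => lift f a
  | Cube => fun f g =>
      [ffun k => if unlift f.1 k is Some k' then g k' else f.2]
  end.

(* Iso-parametric map of an m-dimensional cell in R^n with vertices x. *)
Definition cell_map (sh : shape) m n (x : vertex sh m -> 'rV[R]_n)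
    (xi : 'rV[R]_m) : 'rV[R]_n :=
  \sum_a ref_basis a xi *: x a.

Definition cell (sh : shape) m n (x : vertex sh m -> 'rV[R]_n) : set 'rV[R]_n :=
  cell_map x @` ref_cell sh m.

(* Integral over a parametrized m-dimensional cell, with respect to its
   m-dimensional surface measure.  Jacobians act on row vectors, hence the
   Gram matrix J *m J^T. *)
Definition cell_integral (sh : shape) m n (x : vertex sh m -> 'rV[R]_n)
    (f : 'rV[R]_n -> R) : R :=
  integral_rV (ref_cell sh m) (fun xi =>
    let J := 'J (cell_map x) xi in
    f (cell_map x xi) * Num.sqrt (\det (J *m J^T))).

End Cells.

Arguments ref_cell : clear implicits.
Arguments ref_face : clear implicits.

Section Meshes.
Variables (R : realType) (d : nat).
Local Notation point := 'rV[R]_d.+1.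

(* Lowest-order elements: the nodes are the vertices of the elements. *)
Record mesh := Mesh {
  nnode : nat;
  nelt : nat;
  node : 'I_nnode -> point;
  elt_shape : 'I_nelt -> shape;
  conn : forall K : 'I_nelt, vertex (elt_shape K) d.+1 -> 'I_nnode
}.
Arguments conn : clear implicits.
Arguments conn {_} K a.

Section OneMesh.
Variable T : mesh.
Implicit Types K L : 'I_(nelt T).

Definition elt_vertex K (a : vertex (elt_shape K) d.+1) : point :=
  node (conn K a).
Definition elt_map K : point -> point := cell_map (@elt_vertex K).
Definition elt K : set point := cell (@elt_vertex K).

Definition elt_nodes K : {set 'I_(nnode T)} :=
  finset (fun r => [exists a, conn K a == r]).

(* Part of K spanned by the vertices with indices in S. *)
Definition elt_face K (S : {set 'I_(nnode T)}) : set point :=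
  elt_map K @` [set xi | ref_cell R (elt_shape K) d.+1 xi /\
    forall a, conn K a \notin S -> ref_basis a xi = 0].

Definition conforming K L : Prop :=
  let S := elt_nodes K :&: elt_nodes L in
  [/\ ref_face _ _ (finset (fun a => conn K a \in S)),
      ref_face _ _ (finset (fun a => conn L a \in S)),
      elt K `&` elt L = elt_face K S &
      elt K `&` elt L = elt_face L S].

Record fe_partition (Om : set point) : Prop := FEPartition {
  fep_node_inj : injective (@node T);
  fep_conn_inj : forall K, injective (conn K);
  fep_node_vertex : forall r, exists K, r \in elt_nodes K;
  fep_elt_inj : forall K,
    {in ref_cell R (elt_shape K) d.+1 &, injective (elt_map K)};
  fep_elt_regular : forall K xi, ref_cell R (elt_shape K) d.+1 xi ->
    \det ('J (elt_map K) xi) != 0;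
  fep_cover : \bigcup_(K in [set: 'I_(nelt T)]) elt K = closure Om;
  fep_disjoint : forall K L, K != L -> (elt K)^° `&` (elt L)^° = set0;
  fep_conforming : forall K L, K != L -> conforming K L
}.

Definition diameter (A : set point) : R :=
  sup [set `|x - y| | x in A & y in A].

Definition mesh_size : R := \big[Num.max/0]_K diameter (elt K).

(* Quasi-uniformity with constant sigma: every element contains a ball of
   radius h / sigma.  Balls and diameters are those of the max norm; another
   norm only changes sigma. *)
Definition quasi_uniform (sigma : R) : Prop :=
  forall K, exists c, ball c (mesh_size / sigma) `<=` elt K.

Definition facet_vertices K (f : ref_facet (elt_shape K) d)
  (a : vertex (elt_shape K) d) : point := elt_vertex (facet_vertex f a).
Definition facet K (f : ref_facet (elt_shape K) d) : set point :=
  cell (facet_vertices f).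

(* The facets lying on gam form a partition of gam. *)
Definition partitions_interface (gam : set point) : Prop :=
  \bigcup_(K in [set: 'I_(nelt T)])
    \bigcup_(f in [set f : ref_facet (elt_shape K) d | facet f `<=` gam])
      facet f = gam.

(* Integral over gam with respect to surface measure, computed facet by facet
   on the partition of gam induced by T.  A facet on gam belongs to one element
   only, since gam lies on the boundary of the meshed domain. *)
Definition interface_integral (gam : set point) (f : point -> R) : R :=
  \sum_K \sum_(e : ref_facet (elt_shape K) d | `[< facet e `<=` gam >])
    cell_integral (facet_vertices e) f.

(* The lowest-order C^0 space S^h; only the values on closure Om matter. *)
Definition fe_space (Om : set point) : set (point -> R) :=
  [set v | {within closure Om, continuous v} /\
    forall K, exists c : vertex (elt_shape K) d.+1 -> R,
      forall xi, ref_cell R (elt_shape K) d.+1 xi ->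
        v (elt_map K xi) = \sum_a c a * ref_basis a xi].

Definition nodal_basis (Om : set point) (N : 'I_(nnode T) -> point -> R) :=
  (forall r, fe_space Om (N r)) /\
  (forall r s, N r (node s) = (r == s)%:R).

(* gam is closed, so nodes lying both on gam and on the remaining part of the
   boundary are those of gam in the closure of the latter. *)
Definition dirichlet_nodes (Om gam : set point) : {set 'I_(nnode T)} :=
  finset (fun r => `[< closure (boundary Om `\` gam) (node r) >]).
Definition interface_nodes (Om gam : set point) : {set 'I_(nnode T)} :=
  finset (fun r => `[< gam (node r) >]) :\: dirichlet_nodes Om gam.
Definition interior_nodes (Om gam : set point) : {set 'I_(nnode T)} :=
  ~: (dirichlet_nodes Om gam :|: interface_nodes Om gam).

Definition mass_block (Om : set point) (N : 'I_(nnode T) -> point -> R)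
    (P Q : {set 'I_(nnode T)}) : 'M[R]_(#|P|, #|Q|) :=
  \matrix_(r, s)
    integral_rV Om (fun x => N (enum_val r) x * N (enum_val s) x).

End OneMesh.

(* Rows: interface nodes Pk of the mesh Tk carrying the multipliers. *)
Definition coupling_mx (gam : set point) (Tk : mesh)
    (Nk : 'I_(nnode Tk) -> point -> R) (Pk : {set 'I_(nnode Tk)}) (Ti : mesh)
    (Ni : 'I_(nnode Ti) -> point -> R) (Pi : {set 'I_(nnode Ti)}) :
    'M[R]_(#|Pk|, #|Pi|) :=
  \matrix_(r, s)
    interface_integral Tk gam (fun x => Nk (enum_val r) x * Ni (enum_val s) x).

Record divided_by (Om Om1 Om2 gam : set point) : Prop := DividedBy {
  div_open : open Om;
  div_bounded : bounded_set Om;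
  div_open1 : open Om1;
  div_open2 : open Om2;
  div_nonempty1 : Om1 !=set0;
  div_nonempty2 : Om2 !=set0;
  div_disjoint : Om1 `&` Om2 = set0;
  div_union : Om `\` gam = Om1 `|` Om2;
  div_interface : gam = boundary Om1 `&` boundary Om2
}.

End Meshes.

Section ReducedBases.
Variable R : realType.

Definition is_svd m n (X : 'M[R]_(m, n)) (U : 'M[R]_m) (D : 'M[R]_(m, n))
    (V : 'M[R]_n) : Prop :=
  [/\ U^T *m U = 1%:M, V^T *m V = 1%:M, X = U *m D *m V^T,
      (forall (i : 'I_m) (j : 'I_n), i != j :> nat -> D i j = 0) /\
      (forall (i : 'I_m) (j : 'I_n), i = j :> nat -> 0 <= D i j) &
      forall (i i' : 'I_m) (j j' : 'I_n), i = j :> nat -> i' = j' :> nat ->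
        (i <= i')%N -> D i' j' <= D i j].

(* The columns of Phi are the first k left singular vectors of X. *)
Definition pod_basis m n k (X : 'M[R]_(m, n)) (Phi : 'M[R]_(m, k)) : Prop :=
  exists (U : 'M[R]_m) (D : 'M[R]_(m, n)) (V : 'M[R]_n) (lekm : (k <= m)%N),
    is_svd X U D V /\ Phi = colsub (widen_ord lekm) U.

Definition pos_def n (A : 'M[R]_n) : Prop :=
  A^T = A /\ forall x : 'cV[R]_n, x != 0 -> 0 < (x^T *m A *m x) ord0 ord0.

End ReducedBases.

Inductive lm_option := rLM | fLM.

Section CoupledProblem.
Variables (R : realType) (d : nat).
Local Notation point := 'rV[R]_d.+1.
Variables (Om1 Om2 gam : set point) (T1 T2 : mesh R d).
Variables (N1 : 'I_(nnode T1) -> point -> R) (N2 : 'I_(nnode T2) -> point -> R).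

Local Notation P1g := (interface_nodes T1 Om1 gam).
Local Notation P10 := (interior_nodes T1 Om1 gam).
Local Notation P2g := (interface_nodes T2 Om2 gam).
Local Notation P20 := (interior_nodes T2 Om2 gam).

Variables (dg d0 : nat) (Phig : 'M[R]_(#|P1g|, dg)) (Phi0 : 'M[R]_(#|P10|, d0)).

Definition rom_mass : 'M[R]_(dg + d0) :=
  block_mx (Phig^T *m mass_block Om1 N1 P1g P1g *m Phig)
           (Phig^T *m mass_block Om1 N1 P1g P10 *m Phi0)
           (Phi0^T *m mass_block Om1 N1 P10 P1g *m Phig)
           (Phi0^T *m mass_block Om1 N1 P10 P10 *m Phi0).

Definition fom_mass : 'M[R]_(#|P2g| + #|P20|) :=
  block_mx (mass_block Om2 N2 P2g P2g) (mass_block Om2 N2 P2g P20)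
           (mass_block Om2 N2 P20 P2g) (mass_block Om2 N2 P20 P20).

Definition lm_dim (opt : lm_option) : nat :=
  match opt with rLM => dg | fLM => #|P2g| end.

Definition Ghat1 (opt : lm_option) : 'M[R]_(lm_dim opt, dg + d0) :=
  match opt return 'M[R]_(lm_dim opt, dg + d0) with
  | rLM => row_mx (Phig^T *m coupling_mx gam N1 P1g N1 P1g *m Phig) 0
  | fLM => row_mx (coupling_mx gam N2 P2g N1 P1g *m Phig) 0
  end.

Definition Ghat2 (opt : lm_option) : 'M[R]_(lm_dim opt, #|P2g| + #|P20|) :=
  match opt return 'M[R]_(lm_dim opt, #|P2g| + #|P20|) with
  | rLM => row_mx (Phig^T *m coupling_mx gam N1 P1g N2 P2g) 0
  | fLM => row_mx (coupling_mx gam N2 P2g N2 P2g) 0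
  end.

Definition schur_complement (opt : lm_option) : 'M[R]_(lm_dim opt) :=
  Ghat1 opt *m invmx rom_mass *m (Ghat1 opt)^T +
  Ghat2 opt *m invmx fom_mass *m (Ghat2 opt)^T.

End CoupledProblem.

(* Main.v *)
Require Import Defs.
From mathcomp Require Import all_boot all_order all_algebra.
From mathcomp Require Import all_classical all_reals all_analysis.
From mathcomp Require Import ring lra.
Import Order.TTheory GRing.Theory Num.Theory.
Import numFieldNormedType.Exports.
Local Open Scope classical_set_scope.
Local Open Scope ring_scope.
Set Implicit Arguments.
Unset Strict Implicit.
Unset Printing Implicit Defensive.

(** Both terms of the Schur complement have the form $G M^{-1} G^T$ with $M$
    symmetric positive definite, so both are positive semidefinite, and the sum
    is positive definite as soon as one of the two matrices $G^T$ is injective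
    ([schur_pos_def]).  For either option the injective one is on the side that
    carries the multipliers: there the interface block of $G$ pairs the
    multiplier basis with the traces of the same functions.  It is the full
    interface mass matrix of the second mesh for fLM, and the congruence by
    $\Phi_{1,\gamma}$ of that of the first mesh for rLM.  The
    block that couples the two meshes contributes only a positive semidefinite
    term.

    What remains is that the volume and interface mass matrices are positive
    definite; the matrices of the reduced problem are congruent to them through
    injective matrices, because POD bases have orthonormal columns
    ([pod_basis_inj]).  A mass matrix is a Gram matrix: its quadratic form at
    $x$ is the integral of $v^2$, where $v$ is the finite element function with
    nodal values $x$ ([gram_quadratic]).  If $x \neq 0$ then $v$ is continuous
    and nonzero at some node, and a continuous nonnegative function on a domain
    whose closure is that of its interior has a positive integral once it is
    positive at one point of the closure ([integral_rV_gt0]).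

    In the volume case this applies to the open set $\Omega_i$, whose closure
    contains the nodes ([fom_mass_pos_def]).  On the interface the integral is
    a sum over facets of integrals over the reference cell, weighted by the
    surface density $\sqrt{\det (J J^T)}$; an interface node lies on some facet
    in $\gamma$, which gives one positive term provided that the density does
    not vanish.  This holds because a facet map is the element map, whose
    Jacobian is invertible, composed with an affine embedding that has an affine
    left inverse ([diff_facet_inj], [coupling_pos_def]). *)

(** * Positive definite matrices *)

Section PositiveDefinite.
Variable R : realType.

Lemma pos_def_unit n (A : 'M[R]_n) : pos_def A -> A \in unitmx.
Proof.
move=> [_ pA]; rewrite -row_free_unit; apply: inj_row_free => v vA0.
apply/eqP; apply: contraT => v0.
have := pA v^T; rewrite trmxK vA0 mul0mx mxE ltxx; apply.
by apply: contra v0 => /eqP v0; rewrite -[v]trmxK v0 trmx0.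
Qed.

Lemma pos_def_congr m n (A : 'M[R]_m) (B : 'M[R]_(m, n)) :
  pos_def A -> (forall x : 'cV_n, B *m x = 0 -> x = 0) ->
  pos_def (B^T *m A *m B).
Proof.
move=> [sA pA] injB; split; first by rewrite !trmx_mul trmxK sA mulmxA.
move=> x x0; have Bx0 : B *m x != 0 by apply: contra x0 => /eqP/injB ->.
by have := pA _ Bx0; rewrite trmx_mul !mulmxA.
Qed.

Lemma pos_semidef_congr m n (A : 'M[R]_m) (B : 'M[R]_(m, n)) (x : 'cV[R]_n) :
  pos_def A -> 0 <= (x^T *m (B^T *m A *m B) *m x) ord0 ord0.
Proof.
move=> [_ pA]; have [Bx0|Bx0] := eqVneq (B *m x) 0.
  by rewrite -!mulmxA Bx0 !mulmx0 mxE.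
by apply: ltW; have := pA _ Bx0; rewrite trmx_mul !mulmxA.
Qed.

(** $A^{-1} = (A^{-1})^T A A^{-1}$ is a congruence of $A$. *)
Lemma pos_def_inv n (A : 'M[R]_n) : pos_def A -> pos_def (invmx A).
Proof.
move=> pA; have uA := pos_def_unit pA.
have iA : (invmx A)^T *m A *m invmx A = invmx A.
  by rewrite -mulmxA mulmxV// mulmx1 trmx_inv pA.1.
rewrite -iA; apply: pos_def_congr => // x iAx0.
by rewrite -[x]mul1mx -(mulmxV uA) -mulmxA iAx0 mulmx0.
Qed.

Lemma pos_defD n (A B : 'M[R]_n) : pos_def A -> B^T = B ->
  (forall x : 'cV_n, 0 <= (x^T *m B *m x) ord0 ord0) -> pos_def (A + B).
Proof.
move=> [sA pA] sB pB; split; first by rewrite linearD/= sA sB.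
by move=> x x0; rewrite mulmxDr mulmxDl mxE ltr_wpDr ?pA.
Qed.

(** Schur complements reduce the dimension: if $a > 0$ is the leading entry,
    then $\det A = a \det (C - a^{-1} b^T b)$, and the Schur complement inherits
    positivity because its quadratic form at $y$ is that of $A$ at
    $(- a^{-1} b y, y)$. *)
Lemma pos_def_det_gt0 n (A : 'M[R]_n) : pos_def A -> 0 < \det A.
Proof.
elim: n A => [|n IHn]; first by move=> A _; rewrite det_mx00.
rewrite -add1n => A; rewrite -[A]submxK; set a := ulsubmx _; set b := ursubmx _.
set b' := dlsubmx _; set C := drsubmx _ => -[sA pA].
have bE : b' = b^T.
  by move: sA; rewrite tr_block_mx => /eq_block_mx[_ <- _ _]; rewrite trmxK.
have sC : C^T = C by move: sA; rewrite tr_block_mx => /eq_block_mx[].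
have a_gt0 : 0 < a ord0 ord0.
  have := pA (col_mx (1%:M : 'cV_1) 0); rewrite tr_col_mx mul_row_block.
  rewrite mul_row_col trmx1 trmx0 !mul0mx !mul1mx mulmx1 mulmx0 !addr0.
  by apply; rewrite col_mx_eq0 negb_and (matrix_nonzero1 R 0).
set t := a ord0 ord0 in a_gt0; have t0 : t != 0 by rewrite gt_eqF.
have aE : a = t%:M by rewrite [a]mx11_scalar.
pose S := C - t^-1 *: (b^T *m b).
have -> : block_mx a b b' C =
    block_mx 1%:M 0 (t^-1 *: b^T) 1%:M *m block_mx a b 0 S.
  rewrite mulmx_block /S !mul1mx !mul0mx !addr0 -!scalemxAl subrKC aE.
  by rewrite mul_mx_scalar scalerA mulVf// scale1r bE.
rewrite det_mulmx det_lblock !det1 !mul1r det_ublock aE det_scalar1.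
apply: mulr_gt0 => //; apply: IHn; split.
  by rewrite /S linearB/= sC linearZ/= trmx_mul trmxK.
move=> y y0; pose z := - t^-1 *: (b *m y).
have := pA (col_mx z y); rewrite col_mx_eq0 negb_and y0 orbT => /(_ isT).
rewrite -mulmxA mul_block_col tr_col_mx mul_row_col aE mul_scalar_mx.
rewrite /z scalerA mulrN mulfV// scaleN1r addNr mulmx0 add0r bE.
rewrite -scalemxAr scaleNr mulmxA; suff -> : y^T *m S *m y =
  y^T *m (- (t^-1 *: (b^T *m b *m y)) + C *m y) by [].
by rewrite -mulmxA /S mulmxBl -scalemxAl addrC.
Qed.

End PositiveDefinite.

(** * Lebesgue measure of sets of row vectors *)

Section MeasureRV.
Variable R : realType.
Local Notation tup n := (n.-tuple (measurableTypeR R)).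

Definition tuple_cube n (a : 'I_n -> R) (r : R) : set (tup n) :=
  [set t | forall j, ball (a j) r (tnth t j)].

Lemma measurable_tuple_cube n (a : 'I_n -> R) r : measurable (tuple_cube a r).
Proof.
have -> : tuple_cube a r =
    \bigcap_j ((fun t : tup n => tnth t j) @^-1` ball (a j) r).
  by apply/seteqP; split => t /= h j => [_|]; exact: h.
rewrite -[X in measurable X]setCK setC_bigcap; apply: measurableC.
apply: countable_bigcupT_measurable; first exact: countableP.
move=> j; apply: measurableC; rewrite -[X in measurable X]setTI.
by apply: measurable_tnth => //; rewrite ball_itv; exact: measurable_itv.
Qed.

Lemma lebesgue_tuple_cube n (a : 'I_n -> R) r : 0 < r ->
  lebesgue_tuple R n (tuple_cube a r) = ((r *+ 2) ^+ n)%:E.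
Proof.
move=> r0; elim: n a => [|n IHn] a.
  have -> : tuple_cube a r = setT by apply/seteqP; split => // t _ [].
  by rewrite /= diracT.
have cubeS : @tuple_pair R n @^-1` tuple_cube a r =
    ball (a ord0) r `*` tuple_cube (fun j => a (lift ord0 j)) r.
  apply/seteqP; split => -[x t] /=.
    move=> h; split; first by have := h ord0; rewrite tnth0.
    by move=> j; have := h (lift ord0 j); rewrite tnthS.
  move=> [xa ta] j; case: (unliftP ord0 j) => [k ->|->].
    by rewrite tnthS; exact: ta.
  by rewrite tnth0.
rewrite /= /lebesgue_cons /pushforward cubeS product_measure1E//.
- rewrite IHn [X in (X * _)%E](lebesgue_measure_ball (a ord0) (ltW r0)).
  by rewrite -EFinM exprS.
- by rewrite ball_itv; exact: measurable_itv.
- exact: measurable_tuple_cube.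
Qed.

Lemma row_of_tuple_ball n (x : 'rV[R]_n) r : 0 < r ->
  @row_of_tuple R n @^-1` ball x r = tuple_cube (x ord0) r.
Proof.
move=> r0; apply/seteqP; split => t /=.
  by move=> [_ h] j; have := h ord0 j; rewrite mxE.
by move=> h; split => // i j; rewrite mxE (ord1 i); exact: h.
Qed.

(** An open set is the union of the balls with rational center and radius that
    it contains, and there are countably many of them. *)
Lemma measurable_open_rV n (U : set 'rV[R]_n) : open U ->
  measurable (@row_of_tuple R n @^-1` U).
Proof.
move=> oU.
pose c (q : 'rV[rat]_n) : 'rV[R]_n := map_mx ratr q.
pose F (p : 'rV[rat]_n * nat) : set (tup n) :=
  if `[< ball (c p.1) p.2.+1%:R^-1 `<=` U >]
  then @row_of_tuple R n @^-1` ball (c p.1) p.2.+1%:R^-1 else set0.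
have -> : @row_of_tuple R n @^-1` U = \bigcup_p F p.
  apply/seteqP; split => [t Ut|t [p _]]; last first.
    by rewrite /F; case: asboolP => // + ?; exact.
  have /nbhs_ballP[e /= e0 eU] : nbhs (row_of_tuple t) U by apply: open_nbhs_nbhs.
  have [k ke] : exists k : nat, k.+1%:R^-1 < e / 2 :> R.
    have := near_infty_natSinv_lt (PosNum (divr_gt0 e0 (ltr0n R 2))).
    by move=> [k _ h]; exists k; exact: h k (leqnn k).
  have k0 : 0 < k.+1%:R^-1 :> R by rewrite invr_gt0 ltr0n.
  have ex j : {q : rat | ball (tnth t j) k.+1%:R^-1 (ratr q : R)}.
    apply/cid; have [q] := rat_in_itvoo (ltr_pwDr k0 (lexx (tnth t j : R))).
    rewrite in_itv/= => /andP[q1 q2]; exists q.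
    by rewrite /ball/= ltr_distlC q2 andbT ltrBlDr (lt_trans q1)// ltrDl.
  pose q : 'rV[rat]_n := \row_j sval (ex j).
  have tq : ball (c q) k.+1%:R^-1 (row_of_tuple t).
    split => // i j; rewrite !mxE; apply: ball_sym; exact: (svalP (ex j)).
  exists (q, k) => //; rewrite /F/=; case: asboolP => // -[] y qy.
  apply: eU; rewrite [e]splitr.
  apply: (@ball_triangle _ _ (c q)); last exact: le_ball (ltW ke) _ qy.
  by apply: ball_sym; exact: le_ball (ltW ke) _ tq.
apply: countable_bigcupT_measurable; first exact: countableP.
move=> [q k]; rewrite /F /=; case: ifP => // _; rewrite row_of_tuple_ball.
  exact: measurable_tuple_cube.
by rewrite invr_gt0 ltr0n.
Qed.

End MeasureRV.

(** * Integrals of continuous functions *)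

Section Quadrature.
Variable R : realType.

(** Open sets and reference cells satisfy the condition on closures.  It excludes
    sets with a part of empty interior, where a continuous function could be
    nonzero without being seen by the integral. *)
Definition quadrature_domain n (A : set 'rV[R]_n) :=
  [/\ bounded_set A, measurable (@row_of_tuple R n @^-1` A) &
      closure A `<=` closure A°].

Lemma bounded_closure n (A : set 'rV[R]_n) :
  bounded_set A -> bounded_set (closure A).
Proof.
move=> [M [Mreal bA]]; exists M; split => // N MN x /= Ax.
suff : closure A `<=` [set y | `|y| <= N] by apply.
rewrite (closure_id [set y : 'rV[R]_n | `|y| <= N]).1; last first.
  apply: (@closed_comp _ _ (fun y : 'rV[R]_n => `|y|) [set r | r <= N]).
    by move=> y _; exact: norm_continuous.
  exact: closed_le.
by apply: closureS => y Ay; exact: bA.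
Qed.

Lemma lebesgue_tuple_bounded n (A : set 'rV[R]_n) :
  bounded_set A -> measurable (@row_of_tuple R n @^-1` A) ->
  (lebesgue_tuple R n (@row_of_tuple R n @^-1` A) < +oo)%E.
Proof.
move=> [M [Mreal bA]] mA; pose r := `|M| + 2; have r0 : 0 < r by rewrite ltr_wpDl.
apply: (@le_lt_trans _ _ (lebesgue_tuple R n (tuple_cube (fun=> 0) r))).
  apply: le_measure; rewrite ?inE//; first exact: measurable_tuple_cube.
  move=> t /= At j; rewrite /ball/= sub0r normrN.
  have := bA (`|M| + 1) _ _ At; rewrite ltr_pwDr ?ler_norm// => /(_ isT).
  rewrite (_ : tnth t j = row_of_tuple t ord0 j) => [tM|]; last by rewrite mxE.
  apply: le_lt_trans (le_trans _ tM) _; last by rewrite /r ltrD2l ltr1n.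
  rewrite [leRHS]/Num.norm/= mx_normrE.
  by apply/bigmax_geP; right; exists (ord0, j).
by rewrite lebesgue_tuple_cube// ltry.
Qed.

Lemma measurable_within_continuous n (A K : set 'rV[R]_n) (f : 'rV[R]_n -> R) :
  measurable (@row_of_tuple R n @^-1` A) -> A `<=` K ->
  {within K, continuous f} ->
  measurable_fun (@row_of_tuple R n @^-1` A)
    (f \o @row_of_tuple R n : n.-tuple (measurableTypeR R) -> R).
Proof.
move=> mA AK /continuousP cf.
apply: (measurability _ (measurable_realfun.RGenOpens.measurableE R)).
move=> _ [_ [a [b ->] <-]].
have /open_subspaceP[V oV VE] := cf _ (interval_open (a := BRight a) (b := BLeft b) isT isT).
have -> : @row_of_tuple R n @^-1` A `&` (f \o @row_of_tuple R n) @^-1` `]a, b[ =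
    @row_of_tuple R n @^-1` A `&` @row_of_tuple R n @^-1` V.
  apply/seteqP; split => t /= [At ft]; split => //.
    have : (f @^-1` `]a, b[ `&` K) (row_of_tuple t) by split => //; exact: AK.
    by rewrite -VE => -[].
  have : (V `&` K) (row_of_tuple t) by split => //; exact: AK.
  by rewrite VE => -[].
by apply: measurableI => //; exact: measurable_open_rV.
Qed.

(** The closure of the domain is compact, so a function that is continuous up to
    the boundary is bounded, and the domain has finite measure. *)
Lemma integrable_rV n (A : set 'rV[R]_n) (f : 'rV[R]_n -> R) :
  quadrature_domain A -> {within closure A, continuous f} ->
  (lebesgue_tuple R n).-integrable (@row_of_tuple R n @^-1` A)
    (EFin \o (f \o @row_of_tuple R n)).
Proof.
move=> [bA mA _] cf; apply: measurable_bounded_integrable => //.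
- exact: lebesgue_tuple_bounded.
- by apply: measurable_within_continuous cf => //; exact: subset_closure.
have /compact_bounded[M [Mreal fM]] : compact (f @` closure A).
  apply: continuous_compact => //; apply: bounded_closed_compact.
    exact: bounded_closure.
  exact: closed_closure.
exists M; split => // N MN t At; apply: fM MN _ _.
by exists (row_of_tuple t) => //; exact: subset_closure.
Qed.

Lemma eq_integral_rV n (A : set 'rV[R]_n) (f g : 'rV[R]_n -> R) :
  {in A, f =1 g} -> integral_rV A f = integral_rV A g.
Proof.
by move=> fg; apply: eq_Rintegral => t /set_mem At; apply: fg; exact/mem_set.
Qed.

Lemma integral_rVZ n (A : set 'rV[R]_n) (f : 'rV[R]_n -> R) c :
  quadrature_domain A -> {within closure A, continuous f} ->
  integral_rV A (fun x => c * f x) = c * integral_rV A f.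
Proof.
move=> qA cf; have [_ mA _] := qA.
by rewrite /integral_rV RintegralZl//; exact: integrable_rV cf.
Qed.

Lemma integral_rV_sum n (A : set 'rV[R]_n) (I : Type) (s : seq I)
    (f : I -> 'rV[R]_n -> R) :
  quadrature_domain A -> (forall i, {within closure A, continuous (f i)}) ->
  integral_rV A (fun x => \sum_(i <- s) f i x) =
  \sum_(i <- s) integral_rV A (f i).
Proof.
move=> qA cf; have [_ mA _] := qA.
have if_ i := integrable_rV qA (cf i).
rewrite /integral_rV /Rintegral.
under eq_integral do rewrite -sumEFin.
rewrite (integral_sum mA if_) sum_fine// => i _.
by have := integrable_fin_num mA (if_ i).
Qed.

(** Density of the interior in the closure moves the point where $f$ is
    positive into the interior; a small cube around it, of positive measure,
    then bounds the integral from below. *)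
Lemma integral_rV_gt0 n (A : set 'rV[R]_n) (f : 'rV[R]_n -> R) y :
  quadrature_domain A -> {within closure A, continuous f} ->
  (forall x, A x -> 0 <= f x) -> closure A y -> 0 < f y ->
  0 < integral_rV A f.
Proof.
move=> qA cf f0 Ay fy; have [bA mA Ai] := qA.
have /subspace_continuousP cfP := cf.
have near_gt x e : closure A x -> e < f x ->
    \forall z \near x, closure A z -> e < f z.
  by move=> Ax fx; have := cfP _ Ax _ (lt_nbhsr fx).
have [x [Ax fx]] : exists x, A° x /\ f y / 2 < f x.
  have fy2 : f y / 2 < f y by rewrite gtr_pMr// invf_lt1// ltr1n.
  have [x [Ax fx]] := Ai _ Ay _ (near_gt _ _ Ay fy2); exists x; split => //.
  by apply: fx; apply: subset_closure; exact: interior_subset.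
have Acx : closure A x by apply: subset_closure; exact: interior_subset.
have [e /= e0 xe] : exists2 e, 0 < e &
    forall z, ball x e z -> A z /\ f y / 2 < f z.
  apply/nbhs_ballP; apply: filterS2 Ax (near_gt _ _ Acx fx) => z Az h.
  by split => //; apply: h; exact: subset_closure.
have e2 : 0 < e / 2 by rewrite divr_gt0.
pose B := ball x e; have mB : measurable (@row_of_tuple R n @^-1` B).
  by rewrite row_of_tuple_ball//; exact: measurable_tuple_cube.
have BA : B `<=` A by move=> z /xe[].
have fint := integrable_rV qA cf.
have f2 : 0 < f y / 2 by rewrite divr_gt0.
have muB : lebesgue_tuple R n (@row_of_tuple R n @^-1` B) = ((e *+ 2) ^+ n)%:E.
  by rewrite row_of_tuple_ball// lebesgue_tuple_cube.
rewrite /integral_rV /Rintegral fine_gt0//; apply/andP; split; last first.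
  exact: integrable_lty fint.
apply: (@lt_le_trans _ _ (\int[lebesgue_tuple R n]_(t in @row_of_tuple R n @^-1` B)
  (f y / 2)%:E)%E).
  by rewrite integral_cst// [X in (_ * X)%E]muB -EFinM lte_fin mulr_gt0// exprn_gt0// pmulrn_lgt0.
apply: (@le_trans _ _ (\int[lebesgue_tuple R n]_(t in @row_of_tuple R n @^-1` B)
  (f (row_of_tuple t))%:E)%E).
  apply: le_integral => //.
  - apply/integrableP; split; first exact: measurable_cst.
    rewrite (eq_integral (fun=> (f y / 2)%:E)); last first.
      by move=> t _; rewrite gee0_abs// lee_fin ltW.
    by rewrite integral_cst// [X in (_ * X)%E]muB -EFinM ltry.
  - by apply: integrableS fint => // t; exact: BA.
  - by move=> t /set_mem /xe[_ /ltW]; rewrite lee_fin.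
apply: ge0_subset_integral => //; last by move=> t; exact: BA.
- exact: measurable_int fint.
- by move=> t At; rewrite lee_fin f0.
Qed.
End Quadrature.

(** * Gram matrices *)

Section Gram.
Variable R : realType.

Lemma within_continuousM (T : topologicalType) (K : set T) (f g : T -> R) :
  {within K, continuous f} -> {within K, continuous g} ->
  {within K, continuous (fun x => f x * g x)}.
Proof. by move=> cf cg x; exact: continuousM (cf x) (cg x). Qed.

Lemma within_continuous_lincomb (T : topologicalType) (K : set T) k
    (x : 'cV[R]_k) (phi : 'I_k -> T -> R) :
  (forall r, {within K, continuous (phi r)}) ->
  {within K, continuous (fun y => \sum_r x r ord0 * phi r y)}.
Proof.
move=> cphi y; apply: cvg_big => [|r _]; first exact: add_continuous.
by apply: continuousM; [exact: cst_continuous|exact: cphi].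
Qed.

(** The quadratic form of a Gram matrix is the integral of a square. *)
Lemma gram_quadratic n (A : set 'rV[R]_n) k (phi : 'I_k -> 'rV[R]_n -> R)
    (w : 'rV[R]_n -> R) (x : 'cV[R]_k) :
  quadrature_domain A -> (forall r, {within closure A, continuous (phi r)}) ->
  {within closure A, continuous w} ->
  (x^T *m (\matrix_(r, s) integral_rV A (fun y => phi r y * phi s y * w y))
     *m x) ord0 ord0 =
  integral_rV A (fun y => (\sum_r x r ord0 * phi r y) ^+ 2 * w y).
Proof.
move=> qA cphi cw.
have cpw r s : {within closure A, continuous (fun y => phi r y * phi s y * w y)}.
  by apply: within_continuousM => //; exact: within_continuousM.
have cc (c : R) f : {within closure A, continuous f} ->
    {within closure A, continuous (fun y => c * f y)}.
  by move=> cf; apply: within_continuousM => // y; exact: cst_continuous.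
rewrite mxE; under eq_bigr => s _.
  rewrite mxE mulr_suml; under eq_bigr => r _ do
    rewrite !mxE mulrAC -integral_rVZ//.
  rewrite -integral_rV_sum//; last by move=> r; exact: cc.
  over.
rewrite -integral_rV_sum//; last first.
  move=> s; rewrite (_ : (fun y => _) = fun y =>
    \sum_r (\col_r (x r ord0 * x s ord0)) r ord0 * (phi r y * phi s y * w y)).
    by apply: within_continuous_lincomb.
  by apply/funext => y; apply: eq_bigr => r _; rewrite mxE.
apply: eq_integral_rV => y _; rewrite expr2 mulr_sumr mulr_suml.
apply: eq_bigr => s _; rewrite mulr_suml mulr_suml; apply: eq_bigr => r _.
ring.
Qed.

Lemma gram_pos_def n (A : set 'rV[R]_n) k (phi : 'I_k -> 'rV[R]_n -> R) :
  quadrature_domain A -> (forall r, {within closure A, continuous (phi r)}) ->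
  (forall x : 'cV[R]_k, x != 0 ->
    exists2 y, closure A y & \sum_r x r ord0 * phi r y != 0) ->
  pos_def (\matrix_(r, s) integral_rV A (fun y => phi r y * phi s y)).
Proof.
move=> qA cphi indep; split.
  apply/matrixP => r s; rewrite !mxE; apply: eq_integral_rV => y _.
  by rewrite mulrC.
move=> x /indep[y Ay y0].
have -> : \matrix_(r, s) integral_rV A (fun y => phi r y * phi s y) =
    \matrix_(r, s) integral_rV A (fun y => phi r y * phi s y * cst 1 y).
  apply/matrixP => r s; rewrite !mxE; apply: eq_integral_rV => z _.
  by rewrite mulr1.
have c1 : {within closure A, continuous (cst 1 : 'rV[R]_n -> R)}.
  by move=> z; exact: cst_continuous.
rewrite gram_quadratic//; apply: (@integral_rV_gt0 _ _ _ _ y) => //.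
- apply: within_continuousM => //; apply: within_continuousM;
  exact: within_continuous_lincomb.
- by move=> z _; rewrite mulr1 sqr_ge0.
- by rewrite mulr1 exprn_even_gt0.
Qed.

End Gram.

(** * Continuously differentiable maps and the surface density *)

Section ContinuouslyDifferentiable.
Variables (R : realType) (V W : normedModType R).

(** The differential is supplied as a witness, with its continuity stated
    direction by direction, so that the calculus rules below follow from those
    for [is_diff]. *)
Definition C1 (f : V -> W) := exists df : V -> V -> W,
  (forall x, is_diff x f (df x)) /\ forall v, continuous (df^~ v).

Lemma C1_differentiable f x : C1 f -> differentiable f x.
Proof. by move=> [df [fdf _]]; have [] := fdf x. Qed.

Lemma C1_continuous f : C1 f -> continuous f.
Proof. by move=> cf x; exact/differentiable_continuous/C1_differentiable. Qed.

Lemma C1_continuous_diff f v : C1 f -> continuous (fun x => 'd f x v).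
Proof.
move=> [df [fdf cdf]]; rewrite (_ : (fun x => _) = df^~ v)//.
by apply/funext => x; have [_ ->] := fdf x.
Qed.

Lemma C1_cst c : C1 (fun=> c).
Proof.
exists (fun=> 0); split; first by move=> x; exact: is_diff_cst.
by move=> v x; exact: cst_continuous.
Qed.

Lemma C1D f g : C1 f -> C1 g -> C1 (fun x => f x + g x).
Proof.
move=> [df [fdf cdf]] [dg [gdg cdg]]; exists (fun x => df x + dg x); split.
  by move=> x; exact: is_diffD.
by move=> v x; exact: (continuousD (cdf v x) (cdg v x)).
Qed.

Lemma C1_sum (I : Type) (s : seq I) (f : I -> V -> W) :
  (forall i, C1 (f i)) -> C1 (fun x => \sum_(i <- s) f i x).
Proof.
move=> cf; elim: s => [|i s IHs].
  by rewrite (_ : (fun x => _) = fun=> 0);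
    [exact: C1_cst|apply/funext => x; rewrite big_nil].
rewrite (_ : (fun x => _) = fun x => f i x + \sum_(j <- s) f j x).
  exact: C1D.
by apply/funext => x; rewrite big_cons.
Qed.

End ContinuouslyDifferentiable.

Section C1Scalar.
Variables (R : realType) (V : normedModType R).

Lemma C1M (f g : V -> R) : C1 f -> C1 g -> C1 (fun x => f x * g x).
Proof.
move=> cf cg; have := C1_continuous cf; have := C1_continuous cg.
case: cf cg => [df [fdf cdf]] [dg [gdg cdg]] cg cf.
exists (fun x => f x *: dg x + g x *: df x); split.
  by move=> x; exact: is_diffM.
move=> v x; exact: (continuousD (continuousM (cf x) (cdg v x))
  (continuousM (cg x) (cdf v x))).
Qed.

Lemma C1Zl (W : normedModType R) (k : V -> R) (u : W) :
  C1 k -> C1 (fun x => k x *: u).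
Proof.
move=> [dk [kdk cdk]]; exists (fun x v => dk x v *: u); split.
  move=> x; have [kx dkx] := kdk x; apply: DiffDef; first exact: differentiableZl.
  by rewrite diffZl// dkx.
by move=> v x; apply: continuousZl; exact: cdk.
Qed.

Lemma C1_prod (I : Type) (s : seq I) (f : I -> V -> R) :
  (forall i, C1 (f i)) -> C1 (fun x => \prod_(i <- s) f i x).
Proof.
move=> cf; elim: s => [|i s IHs].
  by rewrite (_ : (fun x => _) = fun=> 1);
    [exact: C1_cst|apply/funext => x; rewrite big_nil].
rewrite (_ : (fun x => _) = fun x => f i x * \prod_(j <- s) f j x).
  exact: C1M.
by apply/funext => x; rewrite big_cons.
Qed.

Lemma C1N (f : V -> R) : C1 f -> C1 (fun x => - f x).
Proof.
move=> cf; rewrite (_ : (fun x => _) = fun x => -1 * f x).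
  by apply: C1M => //; exact: C1_cst.
by apply/funext => x; rewrite mulN1r.
Qed.

End C1Scalar.

Section Jacobian.
Variable R : realType.

Lemma C1_coord n (j : 'I_n) : C1 (fun x : 'rV[R]_n => x ord0 j : R).
Proof.
have @f : {linear 'rV[R]_n -> R}.
  by exists (fun x : 'rV[R]_n => x ord0 j); do 2![eexists]; do ?[constructor];
     rewrite ?mxE// => ? *; rewrite ?mxE//; move=> ?; rewrite !mxE.
exists (fun=> f); split; last by move=> v x; exact: cst_continuous.
have cf : continuous f by move=> x; exact: coord_continuous.
move=> x; apply: DiffDef; first exact: (linear_differentiable x cf).
exact: (diff_lin x cf).
Qed.

Lemma continuous_sum (T : topologicalType) (I : Type) (s : seq I)
    (f : I -> T -> R) :
  (forall i, continuous (f i)) -> continuous (fun x => \sum_(i <- s) f i x).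
Proof.
move=> cf x; apply: cvg_big => [|i _]; first exact: add_continuous.
exact: cf.
Qed.

Lemma continuous_det (T : topologicalType) n (G : T -> 'M[R]_n) :
  (forall i j, continuous (fun x => G x i j)) ->
  continuous (fun x => \det (G x)).
Proof.
move=> cG x; apply: cvg_big => [|s _]; first exact: add_continuous.
apply: cvgM; first exact: cvg_cst.
by apply: cvg_big => [|i _]; [exact: mul_continuous|exact: cG].
Qed.

(** The factor by which [cell_integral] weights the integrand. *)
Definition surface_density m n (F : 'rV[R]_m -> 'rV[R]_n) xi : R :=
  Num.sqrt (\det ('J F xi *m ('J F xi)^T)).

Lemma continuous_surface_density m n (F : 'rV[R]_m -> 'rV[R]_n) :
  C1 F -> continuous (surface_density F).
Proof.
move=> cF xi; apply: continuous_comp; last exact: sqrt_continuous.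
move: xi; apply: continuous_det => i j.
have cJ k l : continuous (fun xi => 'J F xi k l).
  rewrite (_ : (fun xi => _) = fun xi => ('d F xi (delta_mx ord0 k)) ord0 l).
    move=> xi; apply: (@continuous_comp _ _ _ (fun xi => 'd F xi (delta_mx ord0 k))
      (fun v : 'rV[R]_n => v ord0 l)); last exact: coord_continuous.
    exact: C1_continuous_diff.
  by apply/funext => xi; rewrite !mxE.
rewrite (_ : (fun xi => _) = fun xi => \sum_k 'J F xi i k * 'J F xi j k).
  apply: continuous_sum => k xi; exact: (continuousM (cJ i k xi) (cJ j k xi)).
by apply/funext => xi; rewrite mxE; apply: eq_bigr => k _; rewrite !mxE.
Qed.

(** The Gram matrix $J J^T$ is positive definite as soon as the differential is
    injective. *)
Lemma surface_density_gt0 m n (F : 'rV[R]_m -> 'rV[R]_n) xi :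
  (forall u, 'd F xi u = 0 -> u = 0) -> 0 < surface_density F xi.
Proof.
move=> dF; rewrite sqrtr_gt0; apply: pos_def_det_gt0.
rewrite -{1}[X in X *m _]trmxK -[X in X *m _]mulmx1.
apply: pos_def_congr.
  split=> [|x x0]; first exact: trmx1.
  rewrite mulmx1 mxE; have [k xk] := cV0Pn _ x0.
  rewrite (bigD1 k)//= ltr_pwDl//; first by rewrite mxE -expr2 exprn_even_gt0.
  by apply: sumr_ge0 => i _; rewrite mxE -expr2 sqr_ge0.
move=> x Jx; apply: trmx_inj; rewrite trmx0; apply: dF.
by rewrite -mul_rV_lin1 -[LHS]trmxK trmx_mul trmxK Jx trmx0.
Qed.

End Jacobian.

(** * Reference cells *)

Lemma near_all (T : topologicalType) (I : finType) (P : I -> T -> Prop) (x : T) :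
  (forall i, \forall y \near x, P i y) -> \forall y \near x, forall i, P i y.
Proof. exact: filter_forall. Qed.

Section ReferenceCell.
Variable R : realType.
Implicit Types sh : Defs.shape.

(** Points at which the Lagrange basis is dual to the vertices. *)
Definition ref_vertex sh m : vertex sh m -> 'rV[R]_m :=
  match sh return vertex sh m -> 'rV[R]_m with
  | Simplex => fun a => \row_j (lift ord0 j == a)%:R
  | Cube => fun a => \row_j (a j)%:R
  end.

Lemma ref_vertex_cell sh m (a : vertex sh m) : ref_cell R sh m (ref_vertex a).
Proof.
case: sh a => a /=; last first.
  by move=> j; rewrite mxE; case: (a j); rewrite ?lexx ler01.
split=> [j|]; first by rewrite mxE ler0n.
under eq_bigr do rewrite mxE.
case: (unliftP ord0 a) => [k ->|->]; last first.
  by rewrite big1 ?ler01.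
rewrite (bigD1 k)//= eqxx big1 ?addr0// => j jk.
by rewrite (inj_eq lift_inj) (negbTE jk).
Qed.

Lemma ref_basis_vertex sh m (a b : vertex sh m) :
  ref_basis b (ref_vertex a) = (b == a)%:R.
Proof.
case: sh a b => a b /=.
  case: unliftP => [j ->|->]; first by rewrite mxE.
  under eq_bigr do rewrite mxE.
  case: (unliftP ord0 a) => [k ->|->]; last first.
    by rewrite big1 ?subr0.
  rewrite (bigD1 k)//= eqxx big1 ?addr0 ?subrr// => j jk.
  by rewrite (inj_eq lift_inj) (negbTE jk).
have [->|] := eqVneq b a.
  by apply: big1 => j _; rewrite mxE; case: (a j); rewrite ?subr0.
move=> ba; have [j abj] : exists j, b j != a j.
  apply/existsP; rewrite -negb_forall; apply: contra ba => /forallP h.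
  by apply/eqP/ffunP => j; apply/eqP/h.
rewrite (bigD1 j)//= mxE; move: abj.
by case: (b j); case: (a j) => // _; rewrite ?subrr mul0r.
Qed.

Lemma ref_basis_simplex_sum m (xi : 'rV[R]_m) :
  \sum_(a < m.+1) ref_basis (a : vertex Simplex m) xi = 1.
Proof.
rewrite big_ord_recl /= unlift_none.
by under [X in _ + X]eq_bigr do rewrite liftK; rewrite subrK.
Qed.

Lemma ref_basis_simplex_ge0 m (a : vertex Simplex m) (xi : 'rV[R]_m) :
  ref_cell R Simplex m xi -> 0 <= ref_basis a xi.
Proof.
by move=> [xi0 xi1] /=; case: unliftP => [j _|_]; rewrite ?subr_ge0.
Qed.

Lemma C1_ref_basis sh m (a : vertex sh m) : C1 (@ref_basis R sh m a).
Proof.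
case: sh a => a /=.
  case: unliftP => [j _|_]; first exact: C1_coord.
  apply: C1D; first exact: C1_cst.
  by apply: C1N; apply: C1_sum => j; exact: C1_coord.
apply: C1_prod => j; case: (a j); first exact: C1_coord.
apply: C1D; first exact: C1_cst.
by apply: C1N; exact: C1_coord.
Qed.

Lemma C1_cell_map sh m n (x : vertex sh m -> 'rV[R]_n) : C1 (cell_map x).
Proof. by apply: C1_sum => a; apply: C1Zl; exact: C1_ref_basis. Qed.

Lemma closed_ref_cell sh m : closed (ref_cell R sh m).
Proof.
have cc j : continuous (fun xi : 'rV[R]_m => xi ord0 j).
  by move=> xi; exact: coord_continuous.
have cl0 j : closed [set xi : 'rV[R]_m | 0 <= xi ord0 j].
  by apply: (closed_comp _ (@closed_ge R 0)) => xi _; exact: cc.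
have cl1 (g : 'rV[R]_m -> R) : continuous g -> closed [set xi | g xi <= 1].
  by move=> cg; apply: (closed_comp _ (@closed_le R 1)) => xi _; exact: cg.
case: sh.
  rewrite (_ : ref_cell _ _ _ = (\bigcap_j [set xi : 'rV[R]_m | 0 <= xi ord0 j]) `&`
      [set xi : 'rV[R]_m | \sum_j xi ord0 j <= 1]).
    apply: closedI; first by apply: closed_bigI => j _; exact: cl0.
    by apply: cl1; apply: continuous_sum.
  by apply/seteqP; split => xi /= [h1 h2]; split => // j; [move=> _|]; exact: h1.
rewrite (_ : ref_cell _ _ _ = \bigcap_j ([set xi : 'rV[R]_m | 0 <= xi ord0 j] `&`
    [set xi : 'rV[R]_m | xi ord0 j <= 1])).
  by apply: closed_bigI => j _; apply: closedI; [exact: cl0|exact: cl1].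
apply/seteqP; split => xi /= h j; first by move=> _; apply/andP/h.
by have [? ?] := h j I; apply/andP.
Qed.

Lemma bounded_ref_cell sh m : bounded_set (ref_cell R sh m).
Proof.
exists 1; split => // M M1 xi xiC; apply: le_trans (ltW M1).
suff xi01 j : 0 <= xi ord0 j <= 1.
  rewrite /Num.norm/= mx_normrE; apply: bigmax_le => // -[i j] _ /=.
  by rewrite (ord1 i); have /andP[? ?] := xi01 j; rewrite ger0_norm.
case: sh xiC => /= [[h0 h1]|]; last exact.
rewrite h0 (le_trans _ h1)// (bigD1 j)//= lerDl.
by apply: sumr_ge0 => k _; exact: h0.
Qed.

(** Shrinking towards the point with equal coordinates $1/(m+2)$ moves every
    point of the reference cell into the interior. *)
Lemma quadrature_domain_ref_cell sh m : quadrature_domain (ref_cell R sh m).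
Proof.
have clC := @closed_ref_cell sh m.
split; first exact: bounded_ref_cell.
  rewrite -[X in measurable X]setCK; apply: measurableC.
  by rewrite preimage_setC; apply: measurable_open_rV; rewrite openC.
rewrite -(closure_id _).1// => xi xiC.
pose c : R := m.+2%:R^-1.
have c0 : 0 < c by rewrite invr_gt0 ltr0n.
have mc : m%:R * c < 1 by rewrite ltr_pdivrMr ?ltr0n// mul1r ltr_nat.
pose g (t : R) : 'rV[R]_m := \row_j (xi ord0 j + t * (c - xi ord0 j)).
have cg : continuous g.
  rewrite (_ : g = fun t => xi + t *: (const_mx c - xi)).
    move=> t; apply: cvgD; first exact: cvg_cst.
    by apply: cvgZr_tmp; exact: cvg_id.
  by apply/funext => t; apply/rowP => j; rewrite !mxE.
move=> B; rewrite (_ : xi = g 0); last first.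
  by apply/rowP => j; rewrite mxE mul0r addr0.
move=> /(cg 0) gB; have [t [t0 t1 Bt]] : exists t, [/\ 0 < t, t < 1 & B (g t)].
  have : \forall t \near (0 : R)^'+, [/\ 0 < t, t < 1 & B (g t)].
    near=> t; split.
    - by near: t; exact: nbhs_right_gt.
    - by near: t; exact: nbhs_right_lt.
    - by near: t; exact: cvg_at_right_filter gB.
  by move=> /filter_ex.
exists (g t); split => //.
have t1' : 0 < 1 - t by rewrite subr_gt0.
have gE j : g t ord0 j = (1 - t) * xi ord0 j + t * c by rewrite mxE; ring.
have g0 j : 0 <= xi ord0 j -> 0 < g t ord0 j.
  by move=> xj; rewrite gE ltr_wpDl ?mulr_ge0 ?mulr_gt0// ltW.
have cc j : continuous (fun y : 'rV[R]_m => y ord0 j).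
  by move=> y; exact: coord_continuous.
have near_gt0 : (forall j, 0 <= xi ord0 j) ->
    \forall y \near g t, forall j, 0 < (y : 'rV[R]_m) ord0 j.
  move=> x0; apply: near_all => j.
  exact: (cc j (g t) _ (lt_nbhsr (g0 j (x0 j)))).
rewrite /interior /=; case: sh xiC {clC} => /= [[xi0 xi1]|xi01].
  have cs : continuous (fun y : 'rV[R]_m => \sum_j y ord0 j).
    exact: continuous_sum.
  have gs : \sum_j g t ord0 j < 1.
    under eq_bigr do rewrite gE.
    rewrite big_split/= -!mulr_sumr sumr_const card_ord -mulr_natl; nra.
  apply: filterS2 (near_gt0 xi0) (cs (g t) _ (lt_nbhsl gs)) => y y0 y1.
  by split; [move=> j; exact: ltW|exact: ltW].
have g1 j : g t ord0 j < 1.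
  rewrite gE; have /andP[x0 x1] := xi01 j.
  have c1 : c < 1 by rewrite invf_lt1 ?ltr0n// ltr1n.
  nra.
have near_lt1 : \forall y \near g t, forall j, (y : 'rV[R]_m) ord0 j < 1.
  by apply: near_all => j; exact: (cc j (g t) _ (lt_nbhsl (g1 j))).
have xi0 j : 0 <= xi ord0 j by case/andP: (xi01 j).
apply: filterS2 (near_gt0 xi0) near_lt1 => y y0 y1 j.
by rewrite !ltW.
Unshelve. all: by end_near.
Qed.

End ReferenceCell.

(** * Facets *)

Section Facets.
Variable R : realType.
Implicit Types sh : Defs.shape.

Lemma C1_row n m (g : 'I_m -> 'rV[R]_n -> R) :
  (forall j, C1 (g j)) -> C1 (fun x => \row_j g j x).
Proof.
move=> cg; rewrite (_ : (fun x => _) = fun x => \sum_j g j x *: delta_mx 0 j).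
  by apply: C1_sum => j; exact: C1Zl (cg j).
by apply/funext => x; rewrite [LHS]row_sum_delta; under eq_bigr do rewrite mxE.
Qed.

(** For the simplex the [j]-th coordinate is the barycentric coordinate of the
    vertex [lift ord0 j], which is the barycentric coordinate in the facet of
    the corresponding facet vertex, or 0 for the vertex opposite to the facet.
    For the cube the frozen coordinate is inserted. *)
Definition facet_embed sh d : ref_facet sh d -> 'rV[R]_d -> 'rV[R]_d.+1 :=
  match sh return ref_facet sh d -> 'rV[R]_d -> 'rV[R]_d.+1 with
  | Simplex => fun f xi => \row_j
      if unlift f (lift ord0 j) is Some a
      then ref_basis (a : vertex Simplex d) xi else 0
  | Cube => fun f xi => \row_k
      if unlift f.1 k is Some k' then xi ord0 k' else (f.2 : bool)%:R
  end.

Definition facet_proj sh d : ref_facet sh d -> 'rV[R]_d.+1 -> 'rV[R]_d :=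
  match sh return ref_facet sh d -> 'rV[R]_d.+1 -> 'rV[R]_d with
  | Simplex => fun f y => \row_k
      ref_basis (lift f (lift ord0 k) : vertex Simplex d.+1) y
  | Cube => fun f y => \row_k y ord0 (lift f.1 k)
  end.

Lemma ref_basis_simplex_embed d (f : ref_facet Simplex d)
    (b : vertex Simplex d.+1) (xi : 'rV[R]_d) :
  ref_basis b (facet_embed f xi) =
  if unlift f b is Some a then ref_basis (a : vertex Simplex d) xi else 0.
Proof.
rewrite /=; case: (unliftP ord0 b) => [j ->|->]; first by rewrite mxE.
pose F (b : 'I_d.+2) :=
  if unlift f b is Some a then ref_basis (a : vertex Simplex d) xi else 0 : R.
under eq_bigr do rewrite mxE -/(F _); rewrite -/(F ord0).
apply/eqP; rewrite subr_eq -big_ord_recl; apply/eqP.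
rewrite (bigD1_ord f)//= /F unlift_none add0r.
by under eq_bigr do rewrite liftK; rewrite ref_basis_simplex_sum.
Qed.

Lemma ref_basis_cube_embed d (f : ref_facet Cube d) (b : vertex Cube d.+1)
    (xi : 'rV[R]_d) :
  ref_basis b (facet_embed f xi) = (b f.1 == f.2)%:R *
  ref_basis ([ffun k => b (lift f.1 k)] : vertex Cube d) xi.
Proof.
rewrite /= (bigD1_ord f.1)//= mxE unlift_none; congr (_ * _).
  by case: (b f.1) f.2 => -[]; rewrite ?subrr ?subr0.
by apply: eq_bigr => k _; rewrite mxE liftK ffunE.
Qed.

Lemma facet_embed_cell sh d (f : ref_facet sh d) (xi : 'rV[R]_d) :
  ref_cell R sh d xi -> ref_cell R sh d.+1 (facet_embed f xi).
Proof.
case: sh f => f xiC; last first.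
  move=> j; rewrite mxE; case: unliftP => [k _|_]; first exact: xiC.
  by case: f.2; rewrite ?lexx ler01.
have e0 b : 0 <= ref_basis (b : vertex Simplex d.+1) (facet_embed f xi).
  rewrite ref_basis_simplex_embed; case: unliftP => // a _.
  exact: ref_basis_simplex_ge0.
split=> [j|]; first by have := e0 (lift ord0 j); rewrite /= liftK.
by have := e0 ord0; rewrite /= unlift_none subr_ge0.
Qed.

Lemma facet_embedK sh d (f : ref_facet sh d) :
  cancel (facet_embed f) (facet_proj f).
Proof.
case: sh f => f xi; apply/rowP => k; rewrite mxE; last by rewrite mxE liftK.
by rewrite ref_basis_simplex_embed liftK /= liftK.
Qed.

(** Basis functions attached to vertices outside a facet vanish on it, and the
    other ones restrict to the Lagrange basis of the facet. *)
Lemma cell_map_facet sh d n (x : vertex sh d.+1 -> 'rV[R]_n)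
    (f : ref_facet sh d) (xi : 'rV[R]_d) :
  cell_map (fun a => x (facet_vertex f a)) xi = cell_map x (facet_embed f xi).
Proof.
rewrite /cell_map; case: sh x f => x f.
  rewrite [RHS](bigD1_ord f)// ref_basis_simplex_embed unlift_none scale0r [RHS]add0r.
  by apply: eq_bigr => a _; rewrite ref_basis_simplex_embed liftK.
rewrite [RHS](bigID (fun b : vertex Cube d.+1 => b f.1 == f.2)) [X in _ = _ + X]big1; last first.
  by move=> b /negbTE bf; rewrite ref_basis_cube_embed bf mul0r scale0r.
rewrite addr0 (reindex_onto (facet_vertex f)
  (fun b : vertex Cube d.+1 => [ffun k => b (lift f.1 k)] : vertex Cube d)); last first.
  move=> b /eqP bf; apply/ffunP => k; rewrite ffunE.
  by case: unliftP => [j ->|->]; rewrite ?ffunE.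
have fvK a : [ffun k => facet_vertex f a (lift f.1 k)] = a :> vertex Cube d.
  by apply/ffunP => k; rewrite !ffunE liftK.
apply: eq_big => [a|a _]; first by rewrite fvK eqxx andbT ffunE unlift_none eqxx.
by rewrite ref_basis_cube_embed fvK /= ffunE unlift_none eqxx mul1r.
Qed.

Lemma C1_facet_embed sh d (f : ref_facet sh d) : C1 (facet_embed f).
Proof.
case: sh f => f; apply: C1_row => j; case: unliftP => [k _|_];
  by [exact: C1_cst|exact: C1_coord|exact: (@C1_ref_basis R Simplex)].
Qed.

Lemma C1_facet_proj sh d (f : ref_facet sh d) : C1 (facet_proj f).
Proof.
case: sh f => f; apply: C1_row => j; last exact: C1_coord.
exact: (@C1_ref_basis R Simplex).
Qed.

(** The parametrization of a facet is that of the element composed with an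
    affine embedding that has an affine left inverse, so the chain rule
    transports injectivity of the differential from the element to the facet. *)
Lemma diff_facet_inj sh d n (x : vertex sh d.+1 -> 'rV[R]_n)
    (f : ref_facet sh d) (xi u : 'rV[R]_d) :
  (forall v, 'd (cell_map x) (facet_embed f xi) v = 0 -> v = 0) ->
  'd (cell_map (fun a => x (facet_vertex f a))) xi u = 0 -> u = 0.
Proof.
move=> dx.
have de := C1_differentiable xi (C1_facet_embed f).
rewrite (_ : cell_map _ = cell_map x \o facet_embed f); last first.
  by apply/funext => y; exact: cell_map_facet.
rewrite diff_comp//; last exact/C1_differentiable/C1_cell_map.
move=> /= /dx eu0.
have : 'd (facet_proj f \o facet_embed f) xi u = u.
  rewrite (_ : _ \o _ = id); last by apply/funext => y; exact: facet_embedK.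
  by have [_ ->] := is_diff_id xi.
rewrite diff_comp//; last exact/C1_differentiable/C1_facet_proj.
by rewrite /= eu0 linear0.
Qed.

End Facets.

(** * Mass matrices of a finite element partition *)

Lemma within_continuous_comp_sub (T U V : topologicalType) (A : set T) (B : set U)
    (F : T -> U) (f : U -> V) :
  continuous F -> (forall x, A x -> B (F x)) -> {within B, continuous f} ->
  {within A, continuous (f \o F)}.
Proof.
move=> cF FAB /subspace_continuousP cf; apply/subspace_continuousP => x Ax W fW.
have h : \forall y \near x, B (F y) -> W (f (F y)) :=
  cF x _ (cf _ (FAB _ Ax) _ fW).
by apply: (@filterS _ _ _ _ _ _ h) => y BW Ay; apply: BW; exact: FAB.
Qed.

Lemma sumr2_gt0 (R : realType) (I : finType) (J : I -> finType)
    (P : forall i, pred (J i)) (F : forall i, J i -> R) i j :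
  (forall i j, 0 <= F i j) -> P i j -> 0 < F i j ->
  0 < \sum_i \sum_(j : J i | P i j) F i j.
Proof.
move=> F0 Pij Fij; rewrite (bigD1 i)//=; apply: ltr_pwDl.
  by rewrite (bigD1 j)//=; apply: ltr_pwDl => //; apply: sumr_ge0.
by apply: sumr_ge0 => k _; apply: sumr_ge0.
Qed.

Section FiniteElements.
Variables (R : realType) (d : nat).
Local Notation point := 'rV[R]_d.+1.
Variables (Om gam : set point) (T : mesh R d).
Hypothesis part : fe_partition T Om.
Variable N : 'I_(nnode T) -> point -> R.
Hypothesis basis : nodal_basis Om N.

Lemma elt_closure (K : 'I_(nelt T)) xi :
  ref_cell R (elt_shape K) d.+1 xi -> closure Om (elt_map K xi).
Proof. by move=> xiC; rewrite -(fep_cover part); exists K => //; exists xi. Qed.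

Lemma node_closure r : closure Om (@node _ _ T r).
Proof.
have [K] := fep_node_vertex part r; rewrite inE => /existsP[a /eqP <-].
have := elt_closure (ref_vertex_cell R a); rewrite /elt_map /cell_map.
rewrite (bigD1 a)//= ref_basis_vertex eqxx scale1r big1 ?addr0// => b ba.
by rewrite ref_basis_vertex (negbTE ba) scale0r.
Qed.

Lemma nodal_lincomb k (idx : 'I_k -> 'I_(nnode T)) (x : 'cV[R]_k) r :
  injective idx -> \sum_s x s ord0 * N (idx s) (node (idx r)) = x r ord0.
Proof.
move=> idx_inj; rewrite (bigD1 r)//= basis.2 eqxx mulr1 big1 ?addr0// => s sr.
by rewrite basis.2 (inj_eq idx_inj) (negbTE sr) mulr0.
Qed.

Local Notation Pg := (interface_nodes T Om gam).
Local Notation P0 := (interior_nodes T Om gam).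

(** The two kinds of nodes are disjoint, so the block matrix is the Gram matrix
    of a family of distinct nodal basis functions; a nonzero combination of them is
    nonzero at one of the nodes. *)
Lemma fom_mass_pos_def : quadrature_domain Om -> pos_def (fom_mass Om gam N).
Proof.
move=> qOm.
pose idx (k : 'I_(#|Pg| + #|P0|)) :=
  match fintype.split k with inl r => enum_val r | inr r => enum_val r end.
have idx_inj : injective idx.
  have disj r : r \in Pg -> r \in P0 -> false.
    by rewrite !inE negb_or => rg /andP[_]; rewrite rg.
  move=> k l; rewrite -[k]fintype.splitK -[l]fintype.splitK /idx !unsplitK.
  case: (fintype.split k) (fintype.split l) => [r|r] [s|s] /= rs.
  - by rewrite (enum_val_inj rs).
  - by have := disj _ (enum_valP r); rewrite rs => /(_ (enum_valP s)).
  - by have := disj _ (enum_valP s); rewrite -rs => /(_ (enum_valP r)).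
  - by rewrite (enum_val_inj rs).
have -> : fom_mass Om gam N =
    \matrix_(r, s) integral_rV Om (fun y => N (idx r) y * N (idx s) y).
  apply/matrixP => k l; rewrite mxE /idx -[k]fintype.splitK -[l]fintype.splitK !unsplitK.
  by case: (fintype.split k) (fintype.split l) => [r|r] [s|s];
    rewrite ?block_mxEul ?block_mxEur ?block_mxEdl ?block_mxEdr mxE.
apply: gram_pos_def => // [r|x /cV0Pn[r xr]]; first by have [] := basis.1 (idx r).
exists (node (idx r)); first exact: node_closure.
by rewrite nodal_lincomb.
Qed.

(** On a facet the multipliers are tested against the surface measure, whose
    density is positive because the element map is regular; a nonzero
    combination of the basis functions does not vanish at some interface node,
    and that node lies on a facet. *)
Lemma coupling_pos_def : partitions_interface T gam ->
  pos_def (coupling_mx gam N Pg N Pg).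
Proof.
move=> ifc.
pose F (K : 'I_(nelt T)) (e : ref_facet (elt_shape K) d) :=
  cell_map (facet_vertices e).
pose phi K e (r : 'I_#|Pg|) xi := N (enum_val r) (F K e xi).
pose G K e : 'M[R]_#|Pg| := \matrix_(r, s) integral_rV (ref_cell R (elt_shape K) d)
  (fun xi => phi K e r xi * phi K e s xi * surface_density (F K e) xi).
have GE : coupling_mx gam N Pg N Pg = \sum_K
    \sum_(e : ref_facet (elt_shape K) d | `[< facet e `<=` gam >]) G K e.
  apply/matrixP => r s; rewrite mxE summxE; apply: eq_bigr => K _.
  by rewrite summxE; apply: eq_bigr => e _; rewrite mxE.
have sG K e : (G K e)^T = G K e.
  apply/matrixP => r s; rewrite !mxE; apply: eq_integral_rV => y _.
  by rewrite [phi _ _ s _ * _]mulrC.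
split.
  rewrite GE linear_sum; apply: eq_bigr => K _.
  by rewrite linear_sum; apply: eq_bigr => e _; exact: sG.
move=> x x0.
have FE K e xi : F K e xi = elt_map K (facet_embed e xi) by exact: cell_map_facet.
have cF K e : C1 (F K e) by exact: C1_cell_map.
have qC (K : 'I_(nelt T)) := @quadrature_domain_ref_cell R (elt_shape K) d.
have clC (K : 'I_(nelt T)) : closure (ref_cell R (elt_shape K) d) = ref_cell R (elt_shape K) d.
  by rewrite -(closure_id _).1//; exact: closed_ref_cell.
have cphi K e r : {within closure (ref_cell R (elt_shape K) d),
    continuous (phi K e r)}.
  apply: (@within_continuous_comp_sub _ _ _ _ (closure Om) (F K e)).
  - exact: C1_continuous.
  - by rewrite clC => xi xiC; rewrite FE; apply: elt_closure;
      exact: facet_embed_cell.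
  - by have [] := basis.1 (enum_val r).
have cw K e : {within closure (ref_cell R (elt_shape K) d),
    continuous (surface_density (F K e))}.
  by apply: continuous_subspaceT; exact: continuous_surface_density.
pose q K e xi := (\sum_r x r ord0 * phi K e r xi) ^+ 2 * surface_density (F K e) xi.
have q_ge0 K e xi : 0 <= q K e xi by rewrite mulr_ge0 ?sqr_ge0 ?sqrtr_ge0.
have formE : (x^T *m coupling_mx gam N Pg N Pg *m x) ord0 ord0 = \sum_K
    \sum_(e : ref_facet (elt_shape K) d | `[< facet e `<=` gam >])
      integral_rV (ref_cell R (elt_shape K) d) (q K e).
  rewrite GE mulmx_sumr mulmx_suml summxE; apply: eq_bigr => K _.
  rewrite mulmx_sumr mulmx_suml summxE; apply: eq_bigr => e _.
  exact: gram_quadratic.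
have int_ge0 K e : 0 <= integral_rV (ref_cell R (elt_shape K) d) (q K e).
  by apply: Rintegral_ge0 => xi _; exact: q_ge0.
have [r xr] := cV0Pn _ x0.
have : gam (node (enum_val r)).
  by have := enum_valP r; rewrite !inE => /andP[_ /asboolP].
rewrite -{1}ifc => -[K _ [e /= egam [xi xiC xie]]].
have int_gt0 : 0 < integral_rV (ref_cell R (elt_shape K) d) (q K e).
  apply: (@integral_rV_gt0 _ _ _ _ xi) => //.
  - apply: within_continuousM => //; apply: within_continuousM;
    exact: within_continuous_lincomb.
  - exact: subset_closure.
  rewrite /q mulr_gt0//.
    rewrite exprn_even_gt0//= (_ : \sum_s _ = x r ord0)//.
    rewrite -[RHS](nodal_lincomb x r (@enum_val_inj _ _)).
    by apply: eq_bigr => s _; rewrite -xie.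
  apply: surface_density_gt0 => u; apply: diff_facet_inj => v dv.
  have := fep_elt_regular part (facet_embed_cell e xiC).
  rewrite -unitfE -unitmxE => /mulmxK J_unit.
  by rewrite -[v](J_unit 1%N) mul_rV_lin1 dv mul0mx.
rewrite formE.
exact: (sumr2_gt0 (P := fun K e => `[< facet e `<=` gam >]) int_ge0 (asboolT egam)).
Qed.

End FiniteElements.

(** * The coupled problem *)

Section SaddlePoint.
Variable R : realType.

(** Injectivity of one of the two transposed constraint matrices suffices, since
    the other term is still positive semidefinite. *)
Lemma schur_pos_def p m n (M1 : 'M[R]_m) (M2 : 'M[R]_n) (G1 : 'M[R]_(p, m))
    (G2 : 'M[R]_(p, n)) :
  pos_def M1 -> pos_def M2 ->
  (forall x : 'cV_p, G1^T *m x = 0 -> x = 0) \/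
  (forall x : 'cV_p, G2^T *m x = 0 -> x = 0) ->
  pos_def (G1 *m invmx M1 *m G1^T + G2 *m invmx M2 *m G2^T).
Proof.
move=> /pos_def_inv p1 /pos_def_inv p2.
wlog inj1 : m n M1 M2 G1 G2 p1 p2 / forall x : 'cV_p, G1^T *m x = 0 -> x = 0.
  move=> wl [inj1|inj2]; first by apply: wl => //; left.
  by rewrite addrC; apply: wl => //; left.
move=> _; apply: pos_defD.
- by rewrite -{1}[G1]trmxK; exact: pos_def_congr.
- by rewrite !trmx_mul trmxK p2.1 mulmxA.
- by move=> x; rewrite -{1}[G2]trmxK; exact: pos_semidef_congr.
Qed.

Lemma row_mx0_tr_inj p n (A : 'M[R]_p) (x : 'cV[R]_p) :
  pos_def A -> (row_mx A (0 : 'M[R]_(p, n)))^T *m x = 0 -> x = 0.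
Proof.
move=> pA; rewrite tr_row_mx pA.1 mul_col_mx => /eqP.
rewrite col_mx_eq0 => /andP[/eqP Ax0 _].
by rewrite -[x]mul1mx -(mulVmx (pos_def_unit pA)) -mulmxA Ax0 mulmx0.
Qed.

Lemma pod_basis_inj m n k (X : 'M[R]_(m, n)) (Phi : 'M[R]_(m, k)) (x : 'cV_k) :
  pod_basis X Phi -> Phi *m x = 0 -> x = 0.
Proof.
move=> [U [D [V [lekm [[UU _ _ _ _] PhiE]]]]] Px0.
suff PP : Phi^T *m Phi = 1%:M by rewrite -[x]mul1mx -PP -mulmxA Px0 mulmx0.
apply/matrixP => i j.
have := congr1 (fun A : 'M[R]_m => A (widen_ord lekm i) (widen_ord lekm j)) UU.
rewrite PhiE !mxE -val_eqE /= => <-.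
by apply: eq_bigr => l _; rewrite !mxE.
Qed.

Variables (d : nat) (Om gam : set 'rV[R]_d.+1) (T : mesh R d).
Variable N : 'I_(nnode T) -> 'rV[R]_d.+1 -> R.

(** The reduced mass matrix is the congruence of the full one by the block
    diagonal matrix of the two bases, which is injective whatever the two
    dimensions are. *)
Lemma rom_mass_pos_def dg d0
    (Phig : 'M[R]_(#|interface_nodes T Om gam|, dg))
    (Phi0 : 'M[R]_(#|interior_nodes T Om gam|, d0)) :
  pos_def (fom_mass Om gam N) ->
  (forall x : 'cV_dg, Phig *m x = 0 -> x = 0) ->
  (forall x : 'cV_d0, Phi0 *m x = 0 -> x = 0) ->
  pos_def (rom_mass N Phig Phi0).
Proof.
move=> pM injg inj0.
have -> : rom_mass N Phig Phi0 =
    (block_mx Phig 0 0 Phi0)^T *m fom_mass Om gam N *m block_mx Phig 0 0 Phi0.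
  rewrite tr_block_mx !mulmx_block !trmx0.
  by rewrite !(mul0mx, mulmx0, addr0, add0r).
apply: pos_def_congr => // x; rewrite -[x]vsubmxK mul_block_col.
rewrite !mul0mx addr0 add0r => /eqP; rewrite col_mx_eq0 => /andP[/eqP xg /eqP x0].
by rewrite (injg _ xg) (inj0 _ x0) col_mx0.
Qed.

End SaddlePoint.

Lemma open_quadrature_domain (R : realType) n (A : set 'rV[R]_n) :
  open A -> bounded_set A -> quadrature_domain A.
Proof.
move=> oA bA; split => //; first exact: measurable_open_rV.
by rewrite (interior_id A).1.
Qed.

Theorem mainTheorem4 (R : realType) (d : nat) (dim23 : d.+1 \in [:: 2; 3]%N)
  (Om Om1 Om2 gam : set 'rV[R]_d.+1) (domains : divided_by Om Om1 Om2 gam)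
  (T1 T2 : mesh R d)
  (part1 : fe_partition T1 Om1) (part2 : fe_partition T2 Om2)
  (sigma1 sigma2 : R) (sigma1_gt0 : 0 < sigma1) (sigma2_gt0 : 0 < sigma2)
  (qu1 : quasi_uniform T1 sigma1) (qu2 : quasi_uniform T2 sigma2)
  (ifc1 : partitions_interface T1 gam) (ifc2 : partitions_interface T2 gam)
  (N1 : 'I_(nnode T1) -> 'rV[R]_d.+1 -> R)
  (N2 : 'I_(nnode T2) -> 'rV[R]_d.+1 -> R)
  (basis1 : nodal_basis Om1 N1) (basis2 : nodal_basis Om2 N2)
  (ng n0 dg d0 : nat) (dg_gt0 : (0 < dg)%N) (d0_gt0 : (0 < d0)%N)
  (Xg : 'M[R]_(#|interface_nodes T1 Om1 gam|, ng))
  (X0 : 'M[R]_(#|interior_nodes T1 Om1 gam|, n0))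
  (Phig : 'M[R]_(#|interface_nodes T1 Om1 gam|, dg))
  (Phi0 : 'M[R]_(#|interior_nodes T1 Om1 gam|, d0))
  (podg : pod_basis Xg Phig) (pod0 : pod_basis X0 Phi0)
  (opt : lm_option) :
  [/\ rom_mass N1 Phig Phi0 \in unitmx,
      fom_mass Om2 gam N2 \in unitmx,
      pos_def (schur_complement Om2 N1 N2 Phig Phi0 opt) &
      schur_complement Om2 N1 N2 Phig Phi0 opt \in unitmx].
Proof.
have sub (O : set 'rV[R]_d.+1) : O `<=` Om1 `|` Om2 -> bounded_set O.
  rewrite -(div_union domains) => OOm.
  have [M [Mreal bM]] := div_bounded domains; exists M; split => // m Mm x Ox.
  by apply: bM => //; have [] := OOm _ Ox.
have q1 : quadrature_domain Om1.
  apply: open_quadrature_domain; first exact: div_open1 domains.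
  by apply: sub; exact: subsetUl.
have q2 : quadrature_domain Om2.
  apply: open_quadrature_domain; first exact: div_open2 domains.
  by apply: sub; exact: subsetUr.
have injg := fun x => @pod_basis_inj _ _ _ _ _ _ x podg.
have inj0 := fun x => @pod_basis_inj _ _ _ _ _ _ x pod0.
have pM1 : pos_def (rom_mass N1 Phig Phi0).
  by apply: rom_mass_pos_def => //; exact: fom_mass_pos_def part1 _ basis1 q1.
have pM2 : pos_def (fom_mass Om2 gam N2).
  exact: fom_mass_pos_def part2 _ basis2 q2.
have pS : pos_def (schur_complement Om2 N1 N2 Phig Phi0 opt).
  apply: schur_pos_def => //; case: opt; [left|right] => x.
    apply: row_mx0_tr_inj; apply: pos_def_congr => //.
    exact: coupling_pos_def part1 _ basis1 ifc1.
  apply: row_mx0_tr_inj.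
  exact: coupling_pos_def part2 _ basis2 ifc2.
by split => //; exact: pos_def_unit.
Qed.
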